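(* Let $(M,g)$ be a three-dimensional space of constant curvature, i.e. there is a constant $\lambda$ with $$R_{ijkl}=\lambda\left(g_{ik}g_{jl}-g_{il}g_{jk}\right).$$ Then its Riemann extension is a six-dimensional symmetric space: the curvature tensor ${}^{6}R_{ijkl}$ of the Riemann extension satisfies $${}^{6}R_{ijkl;m}=0,$$ that is, it is parallel with respect to the Levi-Civita connection of the six-dimensional metric.
   Context: Let $g$ be a metric in local coordinates $(x^1,x^2,x^3)$ and let $\Gamma^i_{jk}$ be the Christoffel symbols of its Levi-Civita connection. The Riemann extension of the space is the six-dimensional space with local coordinates $(x^1,x^2,x^3,\psi_1,\psi_2,\psi_3)$ (where $\psi_1,\psi_2,\psi_3$ are additional coordinates) endowed with the metric $${}^{6}ds^2=-2\,\Gamma^i_{jk}(x)\,\psi_i\,dx^j dx^k+2\,dx^i d\psi_i,$$ with summation over repeated indices from 1 to 3; it is a pseudo-Riemannian metric of signature $(3,3)$. The semicolon denotes covariant differentiation with respect to the Levi-Civita connection of the metric concerned; $R_{ijkl}$ denotes the curvature tensor of $g$ and ${}^{6}R_{ijkl}$ (indices from 1 to 6) that of the six-dimensional metric. The sign convention for the curvature tensor is the one for which a space with $R_{ijkl}=\lambda(g_{ik}g_{jl}-g_{il}g_{jk})$ has sectional curvature $\lambda$. *)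

(* Defs.v *)
From mathcomp Require Import all_boot all_order all_algebra.
From mathcomp Require Import all_classical all_reals all_analysis.

Set Implicit Arguments.
Unset Strict Implicit.
Unset Printing Implicit Defensive.

Import Order.TTheory GRing.Theory Num.Theory.
Import numFieldNormedType.Exports.

Local Open Scope classical_set_scope.
Local Open Scope ring_scope.

(* A chart with coordinates x^0, ..., x^(n-1) is an open set of 'rV[R]_n, and a
   tensor field on it is given by its components, which are total functions of
   the point; their values outside the chart are irrelevant, since derivatives
   at a point of an open set only depend on the values near that point. *)

Definition partial (R : realType) (n : nat) (i : 'I_n) (f : 'rV[R]_n -> R)
    (x : 'rV[R]_n) : R :=
  'D_(delta_mx 0 i) f x.

Definition iter_partial (R : realType) (n : nat) (s : seq 'I_n)
    (f : 'rV[R]_n -> R) : 'rV[R]_n -> R :=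
  foldr (@partial R n) f s.

(* C^oo: the partial derivatives of all orders exist and are continuous. *)
Definition smooth_on (R : realType) (n : nat) (U : set 'rV[R]_n)
    (f : 'rV[R]_n -> R) : Prop :=
  forall (s : seq 'I_n) (x : 'rV[R]_n), U x ->
    {for x, continuous (iter_partial s f)} /\
    forall i : 'I_n, derivable (iter_partial s f) x (delta_mx 0 i).

(* A metric of arbitrary signature. *)
Definition metric_on (R : realType) (n : nat) (U : set 'rV[R]_n)
    (g : 'rV[R]_n -> 'M[R]_n) : Prop :=
  [/\ forall i j : 'I_n, smooth_on U (fun x => g x i j),
      forall x, U x -> (g x)^T = g x
    & forall x, U x -> g x \in unitmx].

(* Gamma^i_(jk), for the Levi-Civita connection of g *)
Definition christoffel (R : realType) (n : nat) (g : 'rV[R]_n -> 'M[R]_n)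
    (i j k : 'I_n) (x : 'rV[R]_n) : R :=
  2^-1 * \sum_(l < n) invmx (g x) i l *
    (partial j (fun y => g y l k) x + partial k (fun y => g y l j) x
     - partial l (fun y => g y j k) x).

(* R^i_(jkl), normalised so that R(d_k, d_l) d_j = R^i_(jkl) d_i with
   R(X, Y) = [nabla_X, nabla_Y] - nabla_[X, Y] *)
Definition curvature_up (R : realType) (n : nat) (g : 'rV[R]_n -> 'M[R]_n)
    (i j k l : 'I_n) (x : 'rV[R]_n) : R :=
  partial k (christoffel g i l j) x - partial l (christoffel g i k j) x
  + \sum_(m < n) (christoffel g i k m x * christoffel g m l j x
                  - christoffel g i l m x * christoffel g m k j x).

(* R_(ijkl) *)
Definition curvature (R : realType) (n : nat) (g : 'rV[R]_n -> 'M[R]_n)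
    (i j k l : 'I_n) (x : 'rV[R]_n) : R :=
  \sum_(m < n) g x i m * curvature_up g m j k l x.

(* T_(ijkl;m) *)
Definition covariant_derivative (R : realType) (n : nat)
    (g : 'rV[R]_n -> 'M[R]_n)
    (T : 'I_n -> 'I_n -> 'I_n -> 'I_n -> 'rV[R]_n -> R)
    (i j k l m : 'I_n) (x : 'rV[R]_n) : R :=
  partial m (T i j k l) x
  - \sum_(p < n) (christoffel g p i m x * T p j k l x
                  + christoffel g p j m x * T i p k l x
                  + christoffel g p k m x * T i j p l x
                  + christoffel g p l m x * T i j k p x).

Definition constant_curvature (R : realType) (n : nat) (U : set 'rV[R]_n)
    (g : 'rV[R]_n -> 'M[R]_n) (lambda : R) : Prop :=
  forall x, U x -> forall i j k l : 'I_n,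
    curvature g i j k l x = lambda * (g x i k * g x j l - g x i l * g x j k).

(* The metric - 2 Gamma^i_(jk)(x) psi_i dx^j dx^k + 2 dx^i dpsi_i at the point
   z = row_mx x psi; the term 2 dx^i dpsi_i contributes the two identity
   blocks. *)
Definition riemann_extension (R : realType) (n : nat)
    (g : 'rV[R]_n -> 'M[R]_n) (z : 'rV[R]_(n + n)) : 'M[R]_(n + n) :=
  block_mx
    (\matrix_(j, k)
       (- 2 * \sum_(i < n) christoffel g i j k (lsubmx z) * rsubmx z 0 i))
    1%:M 1%:M 0.

(* Main.v *)
Require Import Defs.
From mathcomp Require Import all_boot all_order all_algebra.
From mathcomp Require Import all_classical all_reals all_analysis.
From mathcomp Require Import ring lra.

Import Order.TTheory GRing.Theory Num.Theory.
Import numFieldNormedType.Exports.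

Local Open Scope classical_set_scope.
Local Open Scope ring_scope.

Set Implicit Arguments.
Unset Strict Implicit.
Unset Printing Implicit Defensive.

(* Let G be the six-dimensional metric and q = g_ij dx^i dx^j the pullback of g
   along (x, psi) |-> x. For a space of constant curvature lambda, the
   curvature tensor of G is lambda times the Kulkarni-Nomizu product of G and q.
   The base Christoffel symbols of G are those of g, and all those with a base
   upper index and a fibre lower index vanish, so q is parallel for the
   Levi-Civita connection of G, as G is; hence so is their product. The second
   derivatives of the Christoffel symbols of g in the curvature of G cancel by
   the symmetry of mixed partial derivatives. *)

(** * Symmetry of second derivatives *)

(** The product of [G] and q comes from the mixed form of the curvature of g, lambda (delta^i_k g_jl
    - delta^i_l g_jk): [G] pairs base with fibre directions by the identity, so lowering delta gives
    a component of [G] while the factor g stays on the base. The obstacle is the component of the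
    curvature with a fibre upper index and three base lower indices. It is linear in psi, and its
    coefficients mix second derivatives of the Christoffel symbols, first derivatives times symbols,
    and cubic terms. Constant curvature is therefore used before differentiating: it trades two of
    the three first derivatives in a fibre symbol for algebraic terms. The derivative along x^k then
    contains a single second derivative, d_k d_l Gamma^r_(ja), symmetric in k and l. What remains is
    an identity between the values at one point of the symbols, their first derivatives and g. *)

Section DirectionalDerivative.
Variables (R : realType) (V : normedModType R).
Implicit Types (f : V -> R) (u v x : V).

Lemma is_derive_shift_arg f u v x df :
  is_derive (u + x) v f df -> is_derive x v (fun y => f (u + y)) df.
Proof.
have E : (fun h : R => h^-1 *: (f (u + (h *: v + x)) - f (u + x))) =
         (fun h => h^-1 *: (f (h *: v + (u + x)) - f (u + x))).
  by apply/funext => h; rewrite addrCA.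
by move=> [d <-]; split; [rewrite /derivable /= E | rewrite /derive /= E].
Qed.

Lemma is_derive_line f u x (t : R) df :
  is_derive (t *: u + x) u f df -> is_derive t 1 (fun s => f (s *: u + x)) df.
Proof.
have E : (fun h : R => h^-1 *: (f ((h *: 1 + t) *: u + x) - f (t *: u + x))) =
         (fun h => h^-1 *: (f (h *: u + (t *: u + x)) - f (t *: u + x))).
  by apply/funext => h; rewrite [h *: 1]mulr1 scalerDl addrA.
by move=> [d <-]; split; [rewrite /derivable /= E | rewrite /derive /= E].
Qed.

Lemma derive_mean_value f u x (h : R) : 0 <= h ->
  (forall t, 0 <= t <= h -> derivable f (t *: u + x) u) ->
  exists2 t, 0 <= t <= h &
    f (h *: u + x) - f x = 'D_u f (t *: u + x) * h.
Proof.
move=> h0 df.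
pose phi s := f (s *: u + x).
have dphi t : 0 <= t <= h -> is_derive t 1 phi ('D_u f (t *: u + x)).
  by move=> /df /derivableP; exact: is_derive_line.
have [||t] := @MVT_segment R phi (fun t => 'D_u f (t *: u + x)) 0 h h0.
- by move=> t; rewrite in_itv/= => /andP[t0 th]; apply: dphi; rewrite !ltW.
- apply: derivable_within_continuous => t; rewrite in_itv/= => th.
  by have [] := dphi _ th.
by rewrite in_itv/= /phi scale0r add0r subr0 => th e; exists t.
Qed.

(* Both orders of differentiation are limits of the same second difference
   f (x + hu + hv) - f (x + hu) - f (x + hv) + f x, divided by h^2. *)
Lemma derive_comm f u v x :
  (\forall y \near x, [/\ derivable f y u, derivable f y v,
     derivable ('D_u f) y v & derivable ('D_v f) y u]) ->
  {for x, continuous ('D_v ('D_u f))} -> {for x, continuous ('D_u ('D_v f))} ->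
  'D_v ('D_u f) x = 'D_u ('D_v f) x.
Proof.
have tri (p q r e : R) : `|p - r| < e / 2 -> `|q - r| < e / 2 -> `|p - q| <= e.
  move=> pr; rewrite distrC => rq; apply: (le_trans (ler_distD r p q)).
  by rewrite (splitr e) lerD// ltW.
(* Two mean value theorems: for [f (h *: w' + y) - f y] along [w], then for ['D_w f] along [w']. The
   bound on [h] keeps the whole parallelogram inside the ball. *)
have diff2 (w w' : V) (r h : R) : 0 < h -> h * (`|w| + `|w'|) < r ->
    (forall y, ball x r y -> derivable f y w /\ derivable ('D_w f) y w') ->
    exists2 y, ball x r y &
      f (h *: w + (h *: w' + x)) - f (h *: w + x) - (f (h *: w' + x) - f x)
        = 'D_w' ('D_w f) y * h * h.
  move=> h0 hr df.
  have inB (s t : R) : 0 <= s <= h -> 0 <= t <= h ->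
      ball x r (t *: w' + (s *: w + x)).
    move=> /andP[s0 sh] /andP[t0 th].
    rewrite -ball_normE /= addrA distrC addrK.
    apply: le_lt_trans hr; rewrite (le_trans (ler_normD _ _))// !normrZ.
    rewrite !ger0_norm// mulrDr addrC lerD// ler_wpM2r//.
  have h0h : 0 <= h <= h by rewrite (ltW h0) lexx.
  have h00 : 0 <= (0 : R) <= h by rewrite (ltW h0) lexx.
  have dphi y : derivable f (h *: w' + y) w -> derivable f y w ->
      is_derive y w (fun y => f (h *: w' + y) - f y)
        ('D_w f (h *: w' + y) - 'D_w f y).
    move=> /derivableP /is_derive_shift_arg d1 /derivableP d2.
    by rewrite -[fun y => _]/((fun y => f (h *: w' + y)) - f)%R; apply: is_deriveB.
  have [||s sh] := @derive_mean_value (fun y => f (h *: w' + y) - f y) w x h.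
  - exact: ltW.
  - move=> s sh; apply: (@ex_derive _ _ _ _ _ _ _ (dphi _ _ _)).
      by apply: (df _ _).1; apply: inB.
    by apply: (df _ _).1; have := inB s 0 sh h00; rewrite scale0r add0r.
  rewrite (@derive_val _ _ _ _ _ _ _ (dphi _ _ _)); first last.
  - by apply: (df _ _).1; have := inB s 0 sh h00; rewrite scale0r add0r.
  - by apply: (df _ _).1; apply: inB.
  have [||t th ->] := @derive_mean_value ('D_w f) w' (s *: w + x) h.
  - exact: ltW.
  - by move=> t th; apply: (df _ _).2; apply: inB.
  move=> e; exists (t *: w' + (s *: w + x)); first exact: inB.
  by rewrite -e [h *: w + (h *: w' + x)]addrCA; ring.
move=> dn cvu cuv.
set a := 'D_v _ x; set b := 'D_u _ x.
apply/eqP; rewrite -subr_eq0 -normr_le0; apply/ler_addgt0Pl => e e0.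
rewrite addr0.
have e2 : 0 < e / 2 by rewrite divr_gt0.
move/cvgrPdist_lt : cvu => /(_ _ e2) nu.
move/cvgrPdist_lt : cuv => /(_ _ e2) nv.
have /nbhs_ballP[r /= r0 Br] : nbhs x ([set y | [/\ derivable f y u,
    derivable f y v, derivable ('D_u f) y v & derivable ('D_v f) y u]] `&`
    ([set y | `|a - 'D_v ('D_u f) y| < e / 2] `&`
     [set y | `|b - 'D_u ('D_v f) y| < e / 2])).
  by apply: filterI; [exact: dn | apply: filterI; [exact: nu | exact: nv]].
(* The summand 1 keeps the denominator positive when [u] and [v] vanish, and gives the strict bound
   h (|u| + |v|) < h (1 + |u| + |v|) = r / 2. *)
pose h := r / (1 + `|u| + `|v|) / 2.
have p0 : 0 < 1 + `|u| + `|v| by rewrite -addrA ltr_pwDl// addr_ge0.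
have h0 : 0 < h by rewrite !divr_gt0.
have hr : h * (`|u| + `|v|) < r.
  apply: (@lt_le_trans _ _ (h * (1 + `|u| + `|v|))).
    by rewrite ltr_pM2l// -addrA ltrDr.
  by rewrite /h mulrAC divfK ?gt_eqF// ler_pdivrMr// ler_peMr ?ltW//; lra.
have [||y By E1] := diff2 u v r h h0; first exact: hr.
  by move=> y /Br[[]].
have [||z Bz E2] := diff2 v u r h h0; first by rewrite addrC.
  by move=> z /Br[[]].
have E : 'D_v ('D_u f) y = 'D_u ('D_v f) z.
  apply: (mulIf (lt0r_neq0 h0)); apply: (mulIf (lt0r_neq0 h0)).
  have swap (p q r' s : R) : p - q - (r' - s) = p - r' - (q - s) by ring.
  rewrite addrCA in E2.
  exact: (etrans (esym E1) (etrans (swap _ _ _ _) E2)).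
have [_ [ay _]] := Br _ By; have [_ [_ bz]] := Br _ Bz.
by apply: tri ay _; rewrite E.
Qed.

End DirectionalDerivative.

(** * Smooth functions *)

Section Smooth.
Variables (R : realType) (n : nat) (U : set 'rV[R]_n).
Hypothesis openU : open U.
Implicit Types (f g : 'rV[R]_n -> R) (x : 'rV[R]_n) (i j : 'I_n).

Lemma near_open x : U x -> \forall y \near x, U y.
Proof. by move=> Ux; apply: open_nbhs_nbhs. Qed.

Lemma partial_ext_on f g i x : U x -> (forall y, U y -> f y = g y) ->
  partial i f x = partial i g x.
Proof.
move=> Ux fg; apply: near_eq_derive.
by apply: filterS (near_open Ux) => y /fg.
Qed.

Lemma smooth_continuous f x : smooth_on U f -> U x -> {for x, continuous f}.
Proof. by move=> sf Ux; have [] := sf [::] x Ux. Qed.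

Lemma smooth_derivable f i x :
  smooth_on U f -> U x -> derivable f x (delta_mx 0 i).
Proof. by move=> sf Ux; have [_ /(_ i)] := sf [::] x Ux. Qed.

(** [foldr] applies the last index first, so a derivative taken beforehand is an index appended at
    the end of the list. *)
Lemma smooth_partial f i : smooth_on U f -> smooth_on U (partial i f).
Proof. by move=> sf s; have := sf (rcons s i); rewrite /iter_partial foldr_rcons. Qed.

Lemma partial_comm f i j x : smooth_on U f -> U x ->
  partial i (partial j f) x = partial j (partial i f) x.
Proof.
move=> sf Ux; apply: derive_comm.
- apply: filterS (near_open Ux) => y Uy.
  have sp k : smooth_on U (partial k f) by exact: smooth_partial.
  split; [exact: (smooth_derivable sf Uy) | exact: (smooth_derivable sf Uy)
    | exact: (smooth_derivable (sp j) Uy) | exact: (smooth_derivable (sp i) Uy)].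
- exact: (smooth_continuous (smooth_partial i (smooth_partial j sf)) Ux).
- exact: (smooth_continuous (smooth_partial j (smooth_partial i sf)) Ux).
Qed.

Lemma partial_cst (a : R) i x : partial i (fun=> a) x = 0.
Proof. exact: derive_cst. Qed.

Lemma partialD f g i x : derivable f x (delta_mx 0 i) ->
  derivable g x (delta_mx 0 i) ->
  partial i (fun y => f y + g y) x = partial i f x + partial i g x.
Proof. exact: deriveD. Qed.

Lemma partialM f g i x : derivable f x (delta_mx 0 i) ->
  derivable g x (delta_mx 0 i) ->
  partial i (fun y => f y * g y) x = partial i f x * g x + f x * partial i g x.
Proof.
move=> df dg; apply: (etrans (deriveM df dg)).
by rewrite addrC; congr (_ + _); exact: mulrC.
Qed.

Lemma partialN f i x : derivable f x (delta_mx 0 i) ->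
  partial i (fun y => - f y) x = - partial i f x.
Proof. exact: deriveN. Qed.

Lemma partialB f g i x : derivable f x (delta_mx 0 i) ->
  derivable g x (delta_mx 0 i) ->
  partial i (fun y => f y - g y) x = partial i f x - partial i g x.
Proof. exact: deriveB. Qed.

Lemma partialMl (a : R) f i x : derivable f x (delta_mx 0 i) ->
  partial i (fun y => a * f y) x = a * partial i f x.
Proof. exact: deriveZ. Qed.

Lemma partial_sum (m : nat) (F : 'I_m -> 'rV[R]_n -> R) i x :
  (forall a, derivable (F a) x (delta_mx 0 i)) ->
  partial i (fun y => \sum_(a < m) F a y) x = \sum_(a < m) partial i (F a) x.
Proof.
move=> dF; apply: etrans (derive_sum dF); congr ('D_ _ _ x).
by apply/funext => y; rewrite fct_sumE.
Qed.

Lemma derivable_sumf (m : nat) (F : 'I_m -> 'rV[R]_n -> R) i x :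
  (forall a, derivable (F a) x (delta_mx 0 i)) ->
  derivable (fun y => \sum_(a < m) F a y) x (delta_mx 0 i).
Proof.
move=> /derivable_sum; rewrite (_ : \sum_(a < m) F a = fun y => \sum_(a < m) F a y).
  exact.
by apply/funext => y; rewrite fct_sumE.
Qed.

(* The smooth functions are the largest family of continuous functions that is
   stable under partial derivatives, and this algebra is such a family. *)
Inductive smooth_algebra : ('rV[R]_n -> R) -> Prop :=
| SmoothGen f : smooth_on U f -> smooth_algebra f
| SmoothCst (a : R) : smooth_algebra (fun=> a)
| SmoothAdd f g : smooth_algebra f -> smooth_algebra g ->
    smooth_algebra (fun y => f y + g y)
| SmoothMul f g : smooth_algebra f -> smooth_algebra g ->
    smooth_algebra (fun y => f y * g y)
| SmoothInv f : (forall y, U y -> f y != 0) -> smooth_algebra f ->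
    smooth_algebra (fun y => (f y)^-1)
| SmoothExt f g : (forall y, U y -> f y = g y) -> smooth_algebra f ->
    smooth_algebra g.

(** Each constructor has a differentiation rule whose result is again built from the constructors.
    These rules are available only on [U], which is what [SmoothExt] absorbs. *)
Lemma smooth_algebra_partial f : smooth_algebra f ->
  [/\ forall x, U x -> {for x, continuous f},
      forall x i, U x -> derivable f x (delta_mx 0 i) &
      forall i, smooth_algebra (partial i f)].
Proof.
elim=> {f}.
- move=> f sf; split=> [x Ux|x i Ux|i].
  + exact: smooth_continuous.
  + exact: smooth_derivable.
  + exact/SmoothGen/smooth_partial.
- move=> a; split=> [x Ux|x i Ux|i].
  + exact: cst_continuous.
  + exact: derivable_cst.
  + apply: (SmoothExt _ (SmoothCst 0)) => y _.
    by rewrite partial_cst.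
- move=> f g _ [cf df pf] _ [cg dg pg]; split=> [x Ux|x i Ux|i].
  + by apply: continuousD; [exact: cf | exact: cg].
  + by apply: derivableD; [exact: df | exact: dg].
  + apply: (SmoothExt _ (SmoothAdd (pf i) (pg i))) => y Uy.
    by rewrite partialD//; [exact: df | exact: dg].
- move=> f g sf [cf df pf] sg [cg dg pg]; split=> [x Ux|x i Ux|i].
  + by apply: continuousM; [exact: cf | exact: cg].
  + by apply: derivableM; [exact: df | exact: dg].
  + apply: (SmoothExt _
      (SmoothAdd (SmoothMul (pf i) sg) (SmoothMul sf (pg i)))) => y Uy.
    by rewrite partialM//; [exact: df | exact: dg].
- move=> f f0 sf [cf df pf]; split=> [x Ux|x i Ux|i].
  + by apply: continuousV; [exact: f0 | exact: cf].
  + by apply: derivableV; [exact: f0 | exact: df].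
  + apply: (SmoothExt _ (SmoothMul (SmoothMul (SmoothCst (-1)) (pf i))
      (SmoothMul (SmoothInv f0 sf) (SmoothInv f0 sf)))) => y Uy.
    rewrite /partial deriveV ?f0//; last exact: df.
    by rewrite expr2 invfM /GRing.scale/=; ring.
- move=> f g fg _ [cf df pf]; split=> [x Ux|x i Ux|i].
  + rewrite /prop_for /continuous_at -(fg _ Ux).
    apply: cvg_trans (cf x Ux).
    have nfg : \forall y \near x, f y = g y.
      by apply: filterS (near_open Ux) => y /fg.
    exact: (near_eq_cvg nfg).
  + apply: near_eq_derivable (df x i Ux).
    by apply: filterS (near_open Ux) => y /fg.
  + by apply: SmoothExt (pf i) => y Uy; exact: partial_ext_on.
Qed.

Lemma smooth_algebraP f : smooth_algebra f -> smooth_on U f.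
Proof.
move=> sf s x Ux.
have : smooth_algebra (iter_partial s f).
  by elim: s => [//|i s /smooth_algebra_partial[_ _]]; exact.
by move=> /smooth_algebra_partial[cf df _]; split=> [|i]; [exact: cf | exact: df].
Qed.

Lemma smooth_cst (a : R) : smooth_on U (fun=> a).
Proof. exact/smooth_algebraP/SmoothCst. Qed.

Lemma smoothD f g :
  smooth_on U f -> smooth_on U g -> smooth_on U (fun y => f y + g y).
Proof. by move=> sf sg; apply/smooth_algebraP/SmoothAdd; exact: SmoothGen. Qed.

Lemma smoothM f g :
  smooth_on U f -> smooth_on U g -> smooth_on U (fun y => f y * g y).
Proof. by move=> sf sg; apply/smooth_algebraP/SmoothMul; exact: SmoothGen. Qed.

Lemma smoothN f : smooth_on U f -> smooth_on U (fun y => - f y).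
Proof.
move=> sf; rewrite (_ : (fun y => - f y) = fun y => -1 * f y).
  exact: smoothM (smooth_cst _) sf.
by apply/funext => y; rewrite mulN1r.
Qed.

Lemma smoothB f g :
  smooth_on U f -> smooth_on U g -> smooth_on U (fun y => f y - g y).
Proof. by move=> sf sg; exact: smoothD sf (smoothN sg). Qed.

Lemma smoothV f : (forall y, U y -> f y != 0) ->
  smooth_on U f -> smooth_on U (fun y => (f y)^-1).
Proof. by move=> f0 sf; apply/smooth_algebraP/SmoothInv => //; exact: SmoothGen. Qed.

Lemma smooth_ext f g :
  (forall y, U y -> f y = g y) -> smooth_on U f -> smooth_on U g.
Proof. by move=> fg sf; apply/smooth_algebraP/(SmoothExt fg)/SmoothGen. Qed.

Lemma smooth_sum (I : Type) (r : seq I) (P : pred I) (F : I -> 'rV[R]_n -> R) :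
  (forall a, smooth_on U (F a)) -> smooth_on U (fun y => \sum_(a <- r | P a) F a y).
Proof.
move=> sF; elim: r => [|a r IH].
  by apply: smooth_ext (smooth_cst 0) => y _; rewrite big_nil.
apply: (@smooth_ext (fun y => (if P a then F a y else 0) +
  \sum_(b <- r | P b) F b y)) => [y _|].
  by rewrite big_cons; case: ifP => // _; rewrite add0r.
by apply: smoothD IH; case: (P a); [exact: sF | exact: smooth_cst].
Qed.

Lemma smooth_prod (I : Type) (r : seq I) (P : pred I) (F : I -> 'rV[R]_n -> R) :
  (forall a, smooth_on U (F a)) -> smooth_on U (fun y => \prod_(a <- r | P a) F a y).
Proof.
move=> sF; elim: r => [|a r IH].
  by apply: smooth_ext (smooth_cst 1) => y _; rewrite big_nil.
apply: (@smooth_ext (fun y => (if P a then F a y else 1) *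
  \prod_(b <- r | P b) F b y)) => [y _|].
  by rewrite big_cons; case: ifP => // _; rewrite mul1r.
by apply: smoothM IH; case: (P a); [exact: sF | exact: smooth_cst].
Qed.

Lemma smooth_det (m : nat) (A : 'rV[R]_n -> 'M[R]_m) :
  (forall a b : 'I_m, smooth_on U (fun y => A y a b)) ->
  smooth_on U (fun y => \det (A y)).
Proof.
move=> sA; rewrite /determinant; apply: smooth_sum => s.
by apply: smoothM; [exact: smooth_cst | apply: smooth_prod => i; exact: sA].
Qed.

(** Cramer's rule: on [U] each entry is a cofactor, polynomial in the entries of [A], divided by a
    determinant without zeros. *)
Lemma smooth_invmx (m : nat) (A : 'rV[R]_n -> 'M[R]_m) :
  (forall a b : 'I_m, smooth_on U (fun y => A y a b)) ->
  (forall y, U y -> A y \in unitmx) ->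
  forall a b : 'I_m, smooth_on U (fun y => invmx (A y) a b).
Proof.
move=> sA uA a b.
have detA y : U y -> \det (A y) != 0.
  by move=> /uA; rewrite unitmxE unitfE.
apply: (@smooth_ext (fun y => (\det (A y))^-1 *
   ((-1) ^+ (b + a) * \det (row' b (col' a (A y)))))) => [y Uy|].
  by rewrite /invmx uA// !mxE.
apply: smoothM; first exact: (smoothV detA (smooth_det sA)).
apply: smoothM; first exact: smooth_cst.
apply: smooth_det => c d.
by apply: smooth_ext (sA (lift b c) (lift a d)) => y _; rewrite !mxE.
Qed.

Lemma smooth_christoffel (g : 'rV[R]_n -> 'M[R]_n) i j k :
  metric_on U g -> smooth_on U (christoffel g i j k).
Proof.
move=> [sg _ ug]; apply: smoothM; first exact: smooth_cst.
apply: smooth_sum => l; apply: smoothM; first exact: smooth_invmx.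
by apply: smoothB; [apply: smoothD|]; apply: smooth_partial; exact: sg.
Qed.

End Smooth.

(** * Algebra of the curvature of the extension *)

Section ConnectionAlgebra.
Variables (R : realType) (n : nat) (lambda : R).
(** Values at one point: [c i j k] stands for Gamma^i_(jk), [d m i j k] for its derivative along
    x^m, [q] for g and [dq m] for the derivative of g along x^m. *)
Variables (c : 'I_n -> 'I_n -> 'I_n -> R) (d : 'I_n -> 'I_n -> 'I_n -> 'I_n -> R).
Variables (q : 'I_n -> 'I_n -> R) (dq : 'I_n -> 'I_n -> 'I_n -> R).
Hypothesis csym : forall i j k, c i j k = c i k j.
Hypothesis dsym : forall m i j k, d m i j k = d m i k j.
Hypothesis qsym : forall i j, q i j = q j i.
Hypothesis dqE : forall m i k,
  dq m i k = \sum_p (c p i m * q p k + c p k m * q i p).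
Hypothesis curv : forall i j k l,
  d k i l j - d l i k j + \sum_m (c i k m * c m l j - c i l m * c m k j)
  = lambda * ((i == k)%:R * q j l - (i == l)%:R * q j k).

(** The coefficient of psi_r in the Christoffel symbol of the extension with fibre upper index [a]
    and base lower indices [l], [j]. *)
Definition fibre_christoffel r a l j :=
  d a r l j - d l r j a - d j r l a + 2 * \sum_s c r a s * c s l j.

(** The formula for R^r_(laj) replaces d_a Gamma^r_(lj) - d_j Gamma^r_(la). The derivative that is
    kept is the one along x^l, so that a further derivative along x^k is symmetric in [k] and
    [l]. *)
Lemma fibre_christoffel_alg r a l j :
  fibre_christoffel r a l j = lambda * ((r == a)%:R * q l j - (r == j)%:R * q l a) - d l r j a
    + \sum_m (c r a m * c m l j + c r j m * c m l a).
Proof.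
rewrite /fibre_christoffel -curv (dsym a r j l) (dsym j r a l) !big_split/= sumrN.
under [\sum_m c r a m * c m j l]eq_bigr do rewrite (csym _ j l).
under [\sum_m c r j m * c m a l]eq_bigr do rewrite (csym _ a l).
ring.
Qed.

Let sum_delta (i : 'I_n) (F : 'I_n -> R) : \sum_m (i == m)%:R * F m = F i.
Proof.
rewrite (bigD1 i)//= eqxx mul1r big1 ?addr0// => m mi.
by rewrite eq_sym (negbTE mi) mul0r.
Qed.

(** The derivative along x^k of the right-hand side of [fibre_christoffel_alg], without its
    second-derivative term, which cancels when [k] and [l] are antisymmetrised. *)
Definition fibre_christoffel_deriv r k a l j :=
  lambda * ((r == a)%:R * dq k l j - (r == j)%:R * dq k l a)
  + \sum_m (d k r a m * c m l j + c r a m * d k m l j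
            + (d k r j m * c m l a + c r j m * d k m l a)).

(** Normal forms for the expansion: [W] is a chain of three symbols, [A] a differentiated symbol
    times a symbol, and [B] the Christoffel symbols of the first kind. *)
Let W r u v w t := \sum_m c r u m * \sum_s c m v s * c s w t.

Let A r u v w t := \sum_m d u r v m * c m w t.

Let B u v w := \sum_m q u m * c m v w.

(** The formula for R^m_(jkl), contracted with Gamma^r_(um). *)
Let first_order r u k l j :
  \sum_m c r u m * d k m l j - \sum_m c r u m * d l m k j =
  lambda * (c r u k * q j l - c r u l * q j k) - W r u k l j + W r u l k j.
Proof.
rewrite -sumrB /W.
rewrite (eq_bigr (fun m => lambda * ((k == m)%:R * (c r u m * q j l)
   - (l == m)%:R * (c r u m * q j k))
  - c r u m * (\sum_s c m k s * c s l j) + c r u m * (\sum_s c m l s * c s k j))).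
  rewrite big_split/= sumrB -mulr_sumr sumrB.
  by rewrite (sum_delta k (fun m => c r u m * q j l))
             (sum_delta l (fun m => c r u m * q j k)).
move=> m _; have := curv m j k l; rewrite sumrB (eq_sym k) (eq_sym l).
set X := \sum_(_ < n) _; set Y := \sum_(_ < n) _ => E.
have -> : d k m l j = d l m k j - X + Y +
  lambda * ((m == k)%:R * q j l - (m == l)%:R * q j k) by rewrite -E; ring.
by ring.
Qed.

Let W_exchange r u v w t : \sum_m (\sum_s c r u s * c s v m) * c m w t = W r u v w t.
Proof.
rewrite /W; under eq_bigr do rewrite mulr_suml.
rewrite exchange_big/=; apply: eq_bigr => s _; rewrite mulr_sumr.
by apply: eq_bigr => m _; rewrite mulrA.
Qed.

(** The other cubic shape: both lower slots of the first symbol are contracted, instead of a chain.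
    Its symmetry under exchange of the two index pairs makes all such terms cancel in pairs. *)
Let V r k a l j := \sum_m \sum_s c r m s * c s k a * c m l j.

Let V_sym r k a l j : V r k a l j = V r l j k a.
Proof.
rewrite /V exchange_big/=; apply: eq_bigr => s _; apply: eq_bigr => m _.
by rewrite (csym r s m); ring.
Qed.

Let contract_right r a k l j : \sum_m fibre_christoffel r a k m * c m l j =
  lambda * ((r == a)%:R * B k l j - q k a * c r l j) - A r k a l j
  + W r a k l j + V r k a l j.
Proof.
rewrite -W_exchange /A /B /V.
rewrite (eq_bigr (fun m => lambda * ((r == a)%:R * (q k m * c m l j)
   - (r == m)%:R * (q k a * c m l j)) - d k r a m * c m l j
  + (\sum_s c r a s * c s k m) * c m l j + \sum_s c r m s * c s k a * c m l j)).
  rewrite !big_split/= sumrN -mulr_sumr sumrB -mulr_sumr.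
  by rewrite (sum_delta r (fun m => q k a * c m l j)).
move=> m _; rewrite fibre_christoffel_alg big_split/= (dsym k r m a).
by rewrite -mulr_suml; ring.
Qed.

Let contract_left r a k l j : \sum_m c m k a * fibre_christoffel r m l j =
  lambda * (c r k a * q l j - (r == j)%:R * B l k a) - A r l j k a
  + V r l j k a + W r j l k a.
Proof.
rewrite -W_exchange /A /B /V.
rewrite (eq_bigr (fun m => lambda * ((r == m)%:R * (c m k a * q l j)
   - (r == j)%:R * (q l m * c m k a)) - d l r j m * c m k a
  + \sum_s c r m s * c s l j * c m k a + (\sum_s c r j s * c s l m) * c m k a)).
  rewrite !big_split/= sumrN -mulr_sumr sumrB -mulr_sumr.
  by rewrite (sum_delta r (fun m => c m k a * q l j)).
move=> m _; rewrite fibre_christoffel_alg big_split/=.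
by rewrite -mulr_suml; ring.
Qed.

(** By metric compatibility both derivatives contain q_(pj) Gamma^p_(kl), which is symmetric in [k]
    and [l] and drops out. *)
Let dqB k l j : dq k l j - dq l k j = B l j k - B k j l.
Proof.
rewrite !dqE /B -!sumrB; apply: eq_bigr => p _.
by rewrite (csym p k l); ring.
Qed.

Let B_sym u v w : B u v w = B u w v.
Proof. by apply: eq_bigr => m _; rewrite csym. Qed.

(** The coefficient of psi_r in the critical curvature component; the two sums come from contraction
    over base and over fibre indices. The [A] terms cancel directly. The undifferentiated symbols
    times derivatives go by [first_order], whose [W] terms cancel those of the contractions. [dqB]
    then leaves only terms in lambda, with the factor -2 of the metric. *)
Lemma fibre_curvature_alg r a j k l :
  fibre_christoffel_deriv r k a l j - fibre_christoffel_deriv r l a k j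
  + \sum_m (fibre_christoffel r a k m * c m l j - fibre_christoffel r a l m * c m k j)
  + \sum_m (c m l a * fibre_christoffel r m k j - c m k a * fibre_christoffel r m l j)
  = - 2 * lambda * (q a k * c r j l - q a l * c r j k).
Proof.
rewrite !sumrB !contract_right !contract_left (V_sym r l j k a) (V_sym r k j l a).
rewrite /fibre_christoffel_deriv !big_split/= -!/(A _ _ _ _ _).
have /eqP := first_order r a k l j; rewrite subr_eq => /eqP ->.
have /eqP := first_order r j k l a; rewrite subr_eq => /eqP ->.
have /eqP := dqB k l j; rewrite subr_eq => /eqP ->.
have /eqP := dqB k l a; rewrite subr_eq => /eqP ->.
rewrite (B_sym k l j) (B_sym l k j) (B_sym k l a) (B_sym l k a).
rewrite (qsym k j) (qsym l j) (qsym l a) (qsym k a) (csym r l j) (csym r k j).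
rewrite (csym r k a) (csym r l a); ring.
Qed.

End ConnectionAlgebra.

(** * Levi-Civita connection *)

Section LeviCivita.
Variables (R : realType) (n : nat) (U : set 'rV[R]_n) (g : 'rV[R]_n -> 'M[R]_n).
Hypotheses (openU : open U) (metric_g : metric_on U g).
Implicit Types (x : 'rV[R]_n) (i j k l m p : 'I_n).

Lemma smooth_metric i j : smooth_on U (fun y => g y i j).
Proof. by case: metric_g. Qed.

Lemma metric_sym x i j : U x -> g x i j = g x j i.
Proof. by case: metric_g => _ sg _ /sg {1}<-; rewrite mxE. Qed.

Lemma metric_mulV x : U x -> g x *m invmx (g x) = 1%:M.
Proof. by case: metric_g => _ _ ug /ug; exact: mulmxV. Qed.

Lemma partial_metric_sym x i j m : U x ->
  partial m (fun y => g y i j) x = partial m (fun y => g y j i) x.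
Proof. by move=> Ux; apply: (partial_ext_on openU) => // y; exact: metric_sym. Qed.

Lemma christoffel_sym x i j k : U x -> christoffel g i j k x = christoffel g i k j x.
Proof.
move=> Ux; congr (_ * _); apply: eq_bigr => l _; congr (_ * _).
by rewrite (partial_metric_sym j k l Ux) addrAC -addrA addrC; ring.
Qed.

Lemma christoffel_lower x l j k : U x ->
  \sum_p g x l p * christoffel g p j k x = 2^-1 *
    (partial j (fun y => g y l k) x + partial k (fun y => g y l j) x
     - partial l (fun y => g y j k) x).
Proof.
move=> Ux; pose v := \col_q (partial j (fun y => g y q k) x
  + partial k (fun y => g y q j) x - partial q (fun y => g y j k) x).
have E p : christoffel g p j k x = (2^-1 *: (invmx (g x) *m v)) p 0.
  by rewrite !mxE; congr (_ * _); apply: eq_bigr => q _; rewrite mxE.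
transitivity ((g x *m (2^-1 *: (invmx (g x) *m v))) l 0).
  by rewrite mxE; apply: eq_bigr => p _; rewrite E.
by rewrite -scalemxAr mulmxA metric_mulV// mul1mx !mxE.
Qed.

(** Metric compatibility: in the sum of the two lowered symbols, the derivatives along x^i and x^k
    cancel and the two halves of the derivative along x^m add up. *)
Lemma partial_metric x i k m : U x -> partial m (fun y => g y i k) x =
  \sum_p (christoffel g p i m x * g x p k + christoffel g p k m x * g x i p).
Proof.
move=> Ux; rewrite big_split/=.
rewrite (eq_bigr (fun p => g x k p * christoffel g p i m x)); last first.
  by move=> p _; rewrite mulrC (metric_sym _ _ Ux).
rewrite [X in _ + X](eq_bigr (fun p => g x i p * christoffel g p k m x)); last first.
  by move=> p _; rewrite mulrC.
rewrite !christoffel_lower//.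
rewrite (partial_metric_sym k m i Ux) (partial_metric_sym k i m Ux).
by rewrite (partial_metric_sym i m k Ux); field.
Qed.

Lemma curvature_upE x i j k l : U x ->
  curvature_up g i j k l x = \sum_m invmx (g x) i m * curvature g m j k l x.
Proof.
move=> Ux; pose v := \col_q curvature_up g q j k l x.
transitivity ((invmx (g x) *m (g x *m v)) i 0).
  by rewrite mulKmx ?mxE//; case: metric_g => _ _; apply.
rewrite mxE; apply: eq_bigr => m _; congr (_ * _); rewrite mxE.
by apply: eq_bigr => p _; rewrite mxE.
Qed.

Lemma curvature_up_constant lambda x i j k l : constant_curvature U g lambda ->
  U x -> curvature_up g i j k l x =
    lambda * ((i == k)%:R * g x j l - (i == l)%:R * g x j k).
Proof.
move=> cg Ux; rewrite curvature_upE//.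
rewrite (eq_bigr (fun m => lambda * ((invmx (g x) i m * g x m k) * g x j l
    - (invmx (g x) i m * g x m l) * g x j k))); last first.
  by move=> m _; rewrite cg//; ring.
rewrite -mulr_sumr sumrB -!mulr_suml.
have E a : \sum_m invmx (g x) i m * g x m a = (i == a)%:R.
  transitivity ((invmx (g x) *m g x) i a); first by rewrite mxE.
  by rewrite mulVmx ?mxE//; case: metric_g => _ _; apply.
by rewrite !E.
Qed.

Definition kulkarni_nomizu (a b : 'rV[R]_n -> 'M[R]_n) i j k l x : R :=
  a x i k * b x j l - a x i l * b x j k + (b x i k * a x j l - b x i l * a x j k).

(** The vanishing covariant derivative is solved for the partial derivative, ready for rewriting;
    derivability is included because the Leibniz rule requires it. *)
Definition parallel (a : 'rV[R]_n -> 'M[R]_n) x := forall i k m,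
  derivable (fun y => a y i k) x (delta_mx 0 m) /\
  partial m (fun y => a y i k) x =
    \sum_p (christoffel g p i m x * a x p k + christoffel g p k m x * a x i p).

Lemma covariant_derivative_parallel lambda (a b : 'rV[R]_n -> 'M[R]_n) x :
  parallel a x -> parallel b x -> forall i j k l m,
  covariant_derivative g (fun i j k l y => lambda * kulkarni_nomizu a b i j k l y)
    i j k l m x = 0.
Proof.
move=> pa pb i j k l m.
have da u v w : derivable (fun y => a y u v) x (delta_mx 0 w) := (pa u v w).1.
have db u v w : derivable (fun y => b y u v) x (delta_mx 0 w) := (pb u v w).1.
have dab u v s t w : derivable (fun y => a y u v * b y s t) x (delta_mx 0 w).
  exact: derivableM (da u v w) (db s t w).
have dba u v s t w : derivable (fun y => b y u v * a y s t) x (delta_mx 0 w).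
  exact: derivableM (db u v w) (da s t w).
have dbaB : derivable (fun y => b y i k * a y j l - b y i l * a y j k)
    x (delta_mx 0 m).
  exact: derivableB (dba i k j l m) (dba i l j k m).
have dabB : derivable (fun y => a y i k * b y j l - a y i l * b y j k)
    x (delta_mx 0 m).
  exact: derivableB (dab i k j l m) (dab i l j k m).
rewrite /covariant_derivative /kulkarni_nomizu.
have -> : partial m (fun y => lambda * (a y i k * b y j l - a y i l * b y j k
    + (b y i k * a y j l - b y i l * a y j k))) x =
  lambda * (partial m (fun y => a y i k) x * b x j l
    + a x i k * partial m (fun y => b y j l) x
    - (partial m (fun y => a y i l) x * b x j k
    + a x i l * partial m (fun y => b y j k) x)
    + (partial m (fun y => b y i k) x * a x j l
    + b x i k * partial m (fun y => a y j l) x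
    - (partial m (fun y => b y i l) x * a x j k
    + b x i l * partial m (fun y => a y j k) x))).
  rewrite (partialMl _ (derivableD dabB dbaB)) (partialD dabB dbaB).
  rewrite (partialB (dab i k j l m) (dab i l j k m)).
  rewrite (partialB (dba i k j l m) (dba i l j k m)).
  rewrite (partialM (da i k m) (db j l m)) (partialM (da i l m) (db j k m)).
  by rewrite (partialM (db i k m) (da j l m)) (partialM (db i l m) (da j k m)).
rewrite !(fun u v w => (pa u v w).2) !(fun u v w => (pb u v w).2).
apply/eqP; rewrite subr_eq0; apply/eqP.
(* Both sides become sums over the same contracted index, and they agree term by term. *)
rewrite !mulr_suml !mulr_sumr -!big_split/= -!sumrB -big_split/= mulr_sumr.
apply: eq_bigr => p _.
move: (christoffel g p i m x) (christoffel g p j m x) => ci cj.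
move: (christoffel g p k m x) (christoffel g p l m x) => ck cl.
by move: (a x) (b x) => ax bx; ring.
Qed.

Lemma parallel_metric x : U x -> parallel g x.
Proof.
move=> Ux i k m; split; first exact: smooth_derivable (smooth_metric i k) Ux.
exact: partial_metric.
Qed.

Lemma curvature_up_antisym x i j k l :
  curvature_up g i j l k x = - curvature_up g i j k l x.
Proof.
rewrite /curvature_up opprD opprB -sumrN; congr (_ + _).
by apply: eq_bigr => m _; rewrite opprB.
Qed.

End LeviCivita.

(** * Riemann extension *)

Section FibreCoordinates.
Variables (R : realType) (n : nat) (U : set 'rV[R]_n).
Hypothesis openU : open U.
Implicit Types (z : 'rV[R]_(n + n)) (a j : 'I_n).

Let W : set 'rV[R]_(n + n) := [set z | U (lsubmx z)].

Lemma open_lsubmx_preimage : open W.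
Proof. exact: ((continuousP lsubmx).1 (@continuous_lsubmx R 1 n n) U openU). Qed.

Let lsubmx_line_l (h : R) j z :
  lsubmx (h *: delta_mx 0 (lshift n j) + z) = h *: delta_mx 0 j + lsubmx z.
Proof. by apply/rowP => i; rewrite !mxE eq_lshift. Qed.

Let lsubmx_line_r (h : R) j z :
  lsubmx (h *: delta_mx 0 (rshift n j) + z) = lsubmx z.
Proof. by apply/rowP => i; rewrite !mxE eq_lrshift andbF mulr0 add0r. Qed.

(** Equality of the difference quotients themselves transfers both derivability and the derivative,
    with no regularity assumed of [F]. *)
Let growth_lsubmx_l (F : 'rV[R]_n -> R) j z :
  (fun h : R => h^-1 *: (F (lsubmx (h *: delta_mx 0 (lshift n j) + z)) - F (lsubmx z)))
  = fun h => h^-1 *: (F (h *: delta_mx 0 j + lsubmx z) - F (lsubmx z)).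
Proof. by apply/funext => h /=; rewrite lsubmx_line_l. Qed.

Lemma partial_lsubmx_l (F : 'rV[R]_n -> R) j :
  partial (lshift n j) (fun z => F (lsubmx z)) = fun z => partial j F (lsubmx z).
Proof.
by apply/funext => z; rewrite /partial /derive/= growth_lsubmx_l.
Qed.

Let growth_lsubmx_r (F : 'rV[R]_n -> R) j z :
  (fun h : R => h^-1 *: (F (lsubmx (h *: delta_mx 0 (rshift n j) + z)) - F (lsubmx z)))
  = fun h => h^-1 *: ((fun=> 0 : R) (h *: delta_mx 0 (rshift n j) + z) -
      (fun=> 0 : R) z).
Proof. by apply/funext => h /=; rewrite lsubmx_line_r !subrr. Qed.

Lemma partial_lsubmx_r (F : 'rV[R]_n -> R) j :
  partial (rshift n j) (fun z => F (lsubmx z)) = fun=> 0.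
Proof.
apply/funext => z; rewrite -[RHS](derive_cst (0 : R) z (delta_mx 0 (rshift n j))).
by rewrite /partial /derive/= growth_lsubmx_r.
Qed.

Lemma smooth_lsubmx (F : 'rV[R]_n -> R) :
  smooth_on U F -> smooth_on W (fun z => F (lsubmx z)).
Proof.
move=> sF s z Wz.
(* An iterated derivative of a lift is the lift of an iterated derivative as long as only base
   directions occur; one fibre direction makes it zero. *)
have [[t ->]|->] : (exists t, iter_partial s (fun z => F (lsubmx z)) =
    fun z => iter_partial t F (lsubmx z)) \/
    iter_partial s (fun z => F (lsubmx z)) = fun=> 0.
- elim: s => [|i s IH]; first by left; exists [::].
  have [j ->|j ->] := split_ordP i; case: IH => [[t /= ->]|/= ->].
  + by left; exists (j :: t); rewrite partial_lsubmx_l.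
  + by right; apply/funext => y; exact: partial_cst.
  + by right; rewrite partial_lsubmx_r.
  + by right; apply/funext => y; exact: partial_cst.
- have [cF dF] := sF t _ Wz; split.
    apply: continuous_comp cF.
    exact: continuous_lsubmx.
  move=> i; have [j ->|j ->] := split_ordP i.
    by have := dF j; rewrite /derivable/= growth_lsubmx_l.
  rewrite /derivable/= growth_lsubmx_r.
  exact: (derivable_cst (0 : R) z (delta_mx 0 (rshift n j))).
- by split=> [|i]; [exact: cst_continuous | exact: derivable_cst].
Qed.

Let derivable_coord z (i : 'I_(n + n)) v : derivable (fun y : 'rV[R]_(n + n) => y 0 i) z v.
Proof. exact: ((derivable_mxP id z v).1 (@derivable_id _ _ z v) 0 i). Qed.

Let fibre_coordE a :
  (fun y : 'rV[R]_(n + n) => rsubmx y 0 a) = fun y => y 0 (rshift n a).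
Proof. by apply/funext => y; rewrite mxE. Qed.

Lemma partial_fibre_coord z a (m : 'I_(n + n)) :
  partial m (fun y => rsubmx y 0 a) z = (m == rshift n a)%:R.
Proof.
have := congr1 (fun A : 'rV[R]_(n + n) => A 0 (rshift n a))
  (derive_mx (@derivable_id _ _ z (delta_mx 0 m))).
by rewrite /partial fibre_coordE derive_id [LHS]mxE [RHS]mxE/= eq_sym => <-.
Qed.

Lemma smooth_fibre_coord a : smooth_on W (fun z => rsubmx z 0 a).
Proof.
have dc z (m : 'I_(n + n)) : derivable (fun y => rsubmx y 0 a) z (delta_mx 0 m).
  by rewrite fibre_coordE; exact: derivable_coord.
have dcZ c z (m : 'I_(n + n)) :
    derivable (fun y => c * rsubmx y 0 a) z (delta_mx 0 m).
  by have := derivableZ (k := c) (dc z m).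
move=> s z _.
(* The affine functions of psi_a form a family stable under all partial derivatives. *)
have [c [e ->]] : exists c e : R, iter_partial s (fun z => rsubmx z 0 a) =
    fun z => c * rsubmx z 0 a + e.
  elim: s => [|m s [c [e /= ->]]].
    by exists 1, 0; apply/funext => y; rewrite mul1r addr0.
  exists 0, (c * (m == rshift n a)%:R); apply/funext => y.
  rewrite mul0r add0r (partialD (dcZ c y m) (@derivable_cst _ _ _ e y (delta_mx 0 m))).
  by rewrite partial_cst addr0 (partialMl _ (dc y m)) partial_fibre_coord.
split=> [|m]; last exact: derivableD (dcZ c z m) (@derivable_cst _ _ _ e z (delta_mx 0 m)).
apply: continuousD; last exact: cst_continuous.
apply: continuousM; first exact: cst_continuous.
by rewrite fibre_coordE; exact: coord_continuous.
Qed.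

End FibreCoordinates.

(** * Metric, inverse metric and Christoffel symbols of the extension *)

Section RiemannExtensionMetric.
Variables (R : realType) (n : nat) (U : set 'rV[R]_n) (g : 'rV[R]_n -> 'M[R]_n).
Hypotheses (openU : open U) (metric_g : metric_on U g).
Implicit Types (z : 'rV[R]_(n + n)) (a b i j k l m p r s : 'I_n).
Implicit Types (I J K L M : 'I_(n + n)).

Let W : set 'rV[R]_(n + n) := [set z | U (lsubmx z)].

Let openW : open W := open_lsubmx_preimage openU.

Local Notation G := (riemann_extension g).
Local Notation lft := (lshift n).
Local Notation rgt := (rshift n).

Let smooth_chr i j k : smooth_on U (christoffel g i j k) :=
  smooth_christoffel openU i j k metric_g.

(** Up to constant factors, the components of [G] and of its connection that depend on psi have this
    form. A base derivative acts on the coefficients; a fibre derivative extracts one of them. *)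
Definition fibre_linear (F : 'I_n -> 'rV[R]_n -> R) z : R :=
  \sum_i F i (lsubmx z) * rsubmx z 0 i.

Section FibreLinear.
Variable F : 'I_n -> 'rV[R]_n -> R.
Hypothesis smF : forall i, smooth_on U (F i).

Let smooth_term i : smooth_on W (fun z => F i (lsubmx z) * rsubmx z 0 i).
Proof. exact (smoothM openW (smooth_lsubmx (smF i)) (smooth_fibre_coord i)). Qed.

Lemma smooth_fibre_linear : smooth_on W (fibre_linear F).
Proof. exact: (smooth_sum openW _ _ smooth_term). Qed.

Let partial_term M i z : W z ->
  partial M (fun z => F i (lsubmx z) * rsubmx z 0 i) z =
  partial M (fun z => F i (lsubmx z)) z * rsubmx z 0 i +
  F i (lsubmx z) * (M == rgt i)%:R.
Proof.
move=> Wz; rewrite -(partial_fibre_coord z i M).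
exact: (partialM (smooth_derivable (smooth_lsubmx (smF i)) Wz)
                 (smooth_derivable (smooth_fibre_coord (U := U) i) Wz)).
Qed.

Lemma partial_fibre_linear_l m z : W z -> partial (lft m) (fibre_linear F) z =
  fibre_linear (fun i => partial m (F i)) z.
Proof.
move=> Wz; rewrite (partial_sum (fun i => smooth_derivable (smooth_term i) Wz)).
apply: eq_bigr => i _; rewrite partial_term// partial_lsubmx_l.
by rewrite eq_lrshift mulr0 addr0.
Qed.

Lemma partial_fibre_linear_r m z : W z ->
  partial (rgt m) (fibre_linear F) z = F m (lsubmx z).
Proof.
move=> Wz; rewrite (partial_sum (fun i => smooth_derivable (smooth_term i) Wz)).
rewrite (bigD1 m)//= partial_term// partial_lsubmx_r mul0r add0r eqxx mulr1.
rewrite big1 ?addr0// => i im; rewrite partial_term// partial_lsubmx_r mul0r add0r.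
by rewrite eq_rshift eq_sym (negbTE im) mulr0.
Qed.

End FibreLinear.

Let H z : 'M[R]_n :=
  \matrix_(j, k) (-2 * fibre_linear (fun i => christoffel g i j k) z).

Let GE : G = fun z => block_mx (H z) 1%:M 1%:M 0.
Proof. by []. Qed.

Lemma riemann_extension_ll z j k :
  G z (lft j) (lft k) = -2 * fibre_linear (fun i => christoffel g i j k) z.
Proof. by rewrite GE block_mxEul mxE. Qed.

Lemma riemann_extension_lr z j k : G z (lft j) (rgt k) = (j == k)%:R.
Proof. by rewrite GE block_mxEur mxE. Qed.

Lemma riemann_extension_rl z j k : G z (rgt j) (lft k) = (j == k)%:R.
Proof. by rewrite GE block_mxEdl mxE. Qed.

Lemma riemann_extension_rr z j k : G z (rgt j) (rgt k) = 0.
Proof. by rewrite GE block_mxEdr mxE. Qed.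

Let inverseE z : G z *m block_mx 0 1%:M 1%:M (- H z) = 1%:M.
Proof.
rewrite GE mulmx_block !mulmx0 !mul0mx !mulmx1 !mul1mx !add0r !addr0 subrr.
by rewrite -scalar_mx_block.
Qed.

Lemma invmx_riemann_extension z : invmx (G z) = block_mx 0 1%:M 1%:M (- H z).
Proof.
have [uG _] := mulmx1_unit (inverseE z).
by rewrite -[LHS]mulmx1 -(inverseE z) mulKmx.
Qed.

Lemma metric_riemann_extension : metric_on W G.
Proof.
split.
- move=> I J; have [i ->|i ->] := split_ordP I; have [j ->|j ->] := split_ordP J.
  + rewrite (_ : (fun z => _) =
      fun z => -2 * fibre_linear (fun r => christoffel g r i j) z); last first.
      by apply/funext => z; rewrite riemann_extension_ll.
    apply: (smoothM openW (smooth_cst openW _)).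
    by apply: smooth_fibre_linear => r; exact: smooth_chr.
  + rewrite (_ : (fun z => _) = fun=> (i == j)%:R); first exact: smooth_cst.
    by apply/funext => z; rewrite riemann_extension_lr.
  + rewrite (_ : (fun z => _) = fun=> (i == j)%:R); first exact: smooth_cst.
    by apply/funext => z; rewrite riemann_extension_rl.
  + rewrite (_ : (fun z => _) = fun=> 0); first exact: smooth_cst.
    by apply/funext => z; rewrite riemann_extension_rr.
- move=> z Wz; rewrite GE tr_block_mx !trmx1 trmx0; congr block_mx.
  apply/matrixP => i j; rewrite !mxE; congr (_ * _); apply: eq_bigr => r _.
  by rewrite (christoffel_sym openU metric_g).
- by move=> z _; have [] := mulmx1_unit (inverseE z).
Qed.

Lemma partial_riemann_extension_lll m j k z : W z ->
  partial (lft m) (fun y => G y (lft j) (lft k)) z =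
  -2 * fibre_linear (fun i => partial m (christoffel g i j k)) z.
Proof.
move=> Wz; rewrite (_ : (fun y => _) =
  fun z => -2 * fibre_linear (fun r => christoffel g r j k) z); last first.
  by apply/funext => y; rewrite riemann_extension_ll.
rewrite (partialMl _ (smooth_derivable (smooth_fibre_linear (smooth_chr^~ j ^~ k)) Wz)).
by rewrite (partial_fibre_linear_l (smooth_chr^~ j ^~ k)).
Qed.

Lemma partial_riemann_extension_rll m j k z : W z ->
  partial (rgt m) (fun y => G y (lft j) (lft k)) z =
  -2 * christoffel g m j k (lsubmx z).
Proof.
move=> Wz; rewrite (_ : (fun y => _) =
  fun z => -2 * fibre_linear (fun r => christoffel g r j k) z); last first.
  by apply/funext => y; rewrite riemann_extension_ll.
rewrite (partialMl _ (smooth_derivable (smooth_fibre_linear (smooth_chr^~ j ^~ k)) Wz)).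
by rewrite (partial_fibre_linear_r (smooth_chr^~ j ^~ k)).
Qed.

Lemma partial_riemann_extension_lr M j k z :
  partial M (fun y => G y (lft j) (rgt k)) z = 0.
Proof.
rewrite (_ : (fun y => _) = fun=> (j == k)%:R); first exact: partial_cst.
by apply/funext => y; rewrite riemann_extension_lr.
Qed.

Lemma partial_riemann_extension_rl M j k z :
  partial M (fun y => G y (rgt j) (lft k)) z = 0.
Proof.
rewrite (_ : (fun y => _) = fun=> (j == k)%:R); first exact: partial_cst.
by apply/funext => y; rewrite riemann_extension_rl.
Qed.

Lemma partial_riemann_extension_rr M j k z :
  partial M (fun y => G y (rgt j) (rgt k)) z = 0.
Proof.
rewrite (_ : (fun y => _) = fun=> 0); first exact: partial_cst.
by apply/funext => y; rewrite riemann_extension_rr.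
Qed.

Let dG := (partial_riemann_extension_lr, partial_riemann_extension_rl,
  partial_riemann_extension_rr).

(** The upper blocks of the inverse metric are zero and the identity, so a base upper index [a] sees
    only the lowered symbol with fibre index [a]. *)
Lemma christoffel_base_general a J K z : christoffel G (lft a) J K z =
  2^-1 * (partial J (fun y => G y (rgt a) K) z + partial K (fun y => G y (rgt a) J) z
    - partial (rgt a) (fun y => G y J K) z).
Proof.
rewrite [LHS]/christoffel; congr (_ * _).
rewrite invmx_riemann_extension big_split_ord [X in X + _ = _]big1; last first.
  by move=> b _; rewrite block_mxEul mxE mul0r.
rewrite add0r (bigD1 a)//= [X in _ + X = _]big1; last first.
  by move=> b ba; rewrite block_mxEur mxE eq_sym (negbTE ba) mul0r.
by rewrite block_mxEur mxE eqxx mul1r addr0.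
Qed.

(** The lower-right block [- H] of the inverse adds the symbols with base upper index; these produce
    the quadratic part of [fibre_christoffel]. *)
Lemma christoffel_fibre_general a J K z : christoffel G (rgt a) J K z =
  2^-1 * (partial J (fun y => G y (lft a) K) z + partial K (fun y => G y (lft a) J) z
    - partial (lft a) (fun y => G y J K) z)
  - \sum_b H z a b * christoffel G (lft b) J K z.
Proof.
rewrite [LHS]/christoffel invmx_riemann_extension big_split_ord mulrDr; congr (_ + _).
  congr (_ * _); rewrite (bigD1 a)//= [X in _ + X = _]big1; last first.
    by move=> b ba; rewrite block_mxEdl mxE eq_sym (negbTE ba) mul0r.
  by rewrite block_mxEdl mxE eqxx mul1r addr0.
rewrite mulr_sumr -sumrN; apply: eq_bigr => b _.
by rewrite christoffel_base_general block_mxEdr [in LHS]mxE mulrCA mulNr.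
Qed.

(** Only the derivative of the base block along psi_a survives, and the factor -2 in the metric
    compensates the -1/2 in front of it. *)
Lemma christoffel_base_base a j k z : W z ->
  christoffel G (lft a) (lft j) (lft k) z = christoffel g a j k (lsubmx z).
Proof.
move=> Wz; rewrite christoffel_base_general !dG partial_riemann_extension_rll//.
by field.
Qed.

Lemma christoffel_base_mixed a j K z : christoffel G (lft a) (rgt j) K z = 0.
Proof.
rewrite christoffel_base_general.
have [k ->|k ->] := split_ordP K; rewrite !dG; ring.
Qed.

Lemma christoffel_base_mixed' a J k z : christoffel G (lft a) J (rgt k) z = 0.
Proof.
rewrite christoffel_base_general.
have [j ->|j ->] := split_ordP J; rewrite !dG; ring.
Qed.

Lemma christoffel_fibre_rr a j k z : christoffel G (rgt a) (rgt j) (rgt k) z = 0.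
Proof.
rewrite christoffel_fibre_general !dG big1 => [|b _]; first by ring.
by rewrite christoffel_base_mixed mulr0.
Qed.

(** The fibre coordinates behave as components of a covector, whence the sign and the transposed
    indices of the dual connection. *)
Lemma christoffel_fibre_lr a j k z : W z ->
  christoffel G (rgt a) (lft j) (rgt k) z = - christoffel g k j a (lsubmx z).
Proof.
move=> Wz; rewrite christoffel_fibre_general !dG big1 => [|b _]; last first.
  by rewrite christoffel_base_mixed' mulr0.
rewrite partial_riemann_extension_rll// (christoffel_sym openU metric_g k a j Wz).
by field.
Qed.

Lemma christoffel_fibre_rl a j k z : W z ->
  christoffel G (rgt a) (rgt j) (lft k) z = - christoffel g j k a (lsubmx z).
Proof.
move=> Wz; rewrite (christoffel_sym openW metric_riemann_extension _ _ _ Wz).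
exact: christoffel_fibre_lr.
Qed.

(** The point comes first, so that at fixed [x] these are the arrays [c] and [d] of the pointwise
    algebra. *)
Definition christoffel_at x i j k := christoffel g i j k x.
Definition partial_christoffel_at x m i j k := partial m (christoffel g i j k) x.

Lemma christoffel_fibre_ll a j k z : W z ->
  christoffel G (rgt a) (lft j) (lft k) z =
  fibre_linear 
    (fun r x => fibre_christoffel (christoffel_at x) (partial_christoffel_at x) r a j k) z.
Proof.
move=> Wz; rewrite christoffel_fibre_general !partial_riemann_extension_lll//.
under eq_bigr do rewrite christoffel_base_base//.
have -> : \sum_b H z a b * christoffel g b j k (lsubmx z) =
  -2 * fibre_linear (fun r x => \sum_s christoffel_at x r a s * christoffel_at x s j k) z.
  rewrite /fibre_linear; under eq_bigr do rewrite mxE.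
  under eq_bigr do rewrite -mulrA.
  rewrite -mulr_sumr; congr (_ * _).
  under eq_bigr do rewrite mulr_suml.
  rewrite exchange_big/=; apply: eq_bigr => r _; rewrite mulr_suml.
  by apply: eq_bigr => s _; rewrite /christoffel_at; ring.
have half (p q r s : R) : 2^-1 * (-2 * p + -2 * q - -2 * r) - -2 * s
    = r - p - q + 2 * s by field.
rewrite half /fibre_linear mulr_sumr -!sumrB -big_split/=.
apply: eq_bigr => r _; rewrite /fibre_christoffel /partial_christoffel_at.
have symP m u v : partial m (christoffel g r u v) (lsubmx z) =
    partial m (christoffel g r v u) (lsubmx z).
  by apply: (partial_ext_on openU) => // y Uy; exact: christoffel_sym Uy.
have factor (u v w q y : R) :
  u * y - v * y - w * y + 2 * (q * y) = (u - v - w + 2 * q) * y by ring.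
by rewrite (symP j a k) (symP k a j) factor.
Qed.

End RiemannExtensionMetric.

(** * Curvature of the extension and its parallelism *)

Section RiemannExtensionCurvature.
Variables (R : realType) (n : nat) (U : set 'rV[R]_n) (g : 'rV[R]_n -> 'M[R]_n).
Variable lambda : R.
Hypotheses (openU : open U) (metric_g : metric_on U g).
Hypothesis curvature_g : constant_curvature U g lambda.
Implicit Types (z : 'rV[R]_(n + n)) (x : 'rV[R]_n) (a b i j k l m p r s : 'I_n).
Implicit Types (I J K L M : 'I_(n + n)).

Let W : set 'rV[R]_(n + n) := [set z | U (lsubmx z)].

Let openW : open W := open_lsubmx_preimage openU.

Local Notation G := (riemann_extension g).
Local Notation lft := (lshift n).
Local Notation rgt := (rshift n).

Let smooth_chr i j k : smooth_on U (christoffel g i j k) :=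
  smooth_christoffel openU i j k metric_g.

Let chr_at := christoffel_at g.
Let dchr_at := partial_christoffel_at g.
Let dmetric_at x m i k := partial m (fun y => g y i k) x.
Let fchr r a l j x := fibre_christoffel (chr_at x) (dchr_at x) r a l j.

Let chr_sym x : U x -> forall i j k, chr_at x i j k = chr_at x i k j.
Proof. by move=> Ux i j k; exact: (christoffel_sym openU metric_g). Qed.

Let dchr_sym x : U x -> forall m i j k, dchr_at x m i j k = dchr_at x m i k j.
Proof.
by move=> Ux m i j k; apply: (partial_ext_on openU m Ux) => y Uy; exact: chr_sym.
Qed.

Let base_curvature x : U x -> forall i j k l,
  dchr_at x k i l j - dchr_at x l i k j +
    \sum_m (chr_at x i k m * chr_at x m l j - chr_at x i l m * chr_at x m k j)
  = lambda * ((i == k)%:R * g x j l - (i == l)%:R * g x j k).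
Proof. by move=> Ux i j k l; exact: (curvature_up_constant metric_g). Qed.

Let smooth_fchr r a l j : smooth_on U (fchr r a l j).
Proof.
have sdc m i' j' k' : smooth_on U (partial m (christoffel g i' j' k')).
  exact: smooth_partial.
apply: (smoothD openU).
  by apply: (smoothB openU); [apply: (smoothB openU)|]; exact: sdc.
apply: (smoothM openU (smooth_cst openU _)); apply: (smooth_sum openU) => s.
exact: (smoothM openU (smooth_chr r a s) (smooth_chr s l j)).
Qed.

Lemma partial_fibre_christoffel r a l j k x : U x ->
  partial k (fchr r a l j) x =
  fibre_christoffel_deriv lambda (chr_at x) (dchr_at x) (dmetric_at x) r k a l j
  - partial k (partial l (christoffel g r j a)) x.
Proof.
move=> Ux.
have dc i' j' k' : derivable (christoffel g i' j' k') x (delta_mx 0 k) :=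
  smooth_derivable (smooth_chr i' j' k') Ux.
have dg i' j' : derivable (fun y => g y i' j') x (delta_mx 0 k) :=
  smooth_derivable (smooth_metric metric_g i' j') Ux.
have dcM i1 j1 k1 i2 j2 k2 : derivable
    (fun y => christoffel g i1 j1 k1 y * christoffel g i2 j2 k2 y) x (delta_mx 0 k).
  exact: derivableM (dc i1 j1 k1) (dc i2 j2 k2).
have dgZ (c : R) i' j' : derivable (fun y => c * g y i' j') x (delta_mx 0 k).
  by have := derivableZ (k := c) (dg i' j').
have dgB : derivable (fun y => (r == a)%:R * g y l j - (r == j)%:R * g y l a)
    x (delta_mx 0 k).
  exact: derivableB (dgZ _ l j) (dgZ _ l a).
have dgBZ : derivable (fun y => lambda *
    ((r == a)%:R * g y l j - (r == j)%:R * g y l a)) x (delta_mx 0 k).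
  by have := derivableZ (k := lambda) dgB.
have ddc : derivable (partial l (christoffel g r j a)) x (delta_mx 0 k) :=
  smooth_derivable (smooth_partial l (smooth_chr r j a)) Ux.
have dcMD m : derivable (fun y => christoffel g r a m y * christoffel g m l j y
    + christoffel g r j m y * christoffel g m l a y) x (delta_mx 0 k).
  exact: derivableD (dcM r a m m l j) (dcM r j m m l a).
(* [fibre_christoffel_alg] holds at every point of the open set [U], so it may be differentiated. *)
rewrite (partial_ext_on (g := fun y =>
    lambda * ((r == a)%:R * g y l j - (r == j)%:R * g y l a)
    - partial l (christoffel g r j a) y
    + \sum_m (christoffel g r a m y * christoffel g m l j y
        + christoffel g r j m y * christoffel g m l a y)) openU k Ux); last first.
  move=> y Uy; exact: (fibre_christoffel_alg (chr_sym Uy) (dchr_sym Uy)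
    (base_curvature Uy)).
rewrite (partialD (derivableB dgBZ ddc) (derivable_sumf dcMD)).
rewrite (partialB dgBZ ddc) (partialMl _ dgB) (partialB (dgZ _ l j) (dgZ _ l a)).
rewrite (partialMl _ (dg l j)) (partialMl _ (dg l a)) (partial_sum dcMD).
rewrite /fibre_christoffel_deriv addrAC; congr (_ + _ - _).
apply: eq_bigr => m _.
rewrite (partialD (dcM r a m m l j) (dcM r j m m l a)).
by rewrite (partialM (dc r a m) (dc m l j)) (partialM (dc r j m) (dc m l a)).
Qed.

Let chr_base a j k z (Wz : W z) :
  christoffel G (lft a) (lft j) (lft k) z = christoffel g a j k (lsubmx z) :=
  christoffel_base_base openU metric_g a j k Wz.

Let chr_rr a j k z : christoffel G (rgt a) (rgt j) (rgt k) z = 0.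
Proof. exact: christoffel_fibre_rr. Qed.

Let chr_lr a j k z (Wz : W z) :
  christoffel G (rgt a) (lft j) (rgt k) z = - christoffel g k j a (lsubmx z) :=
  christoffel_fibre_lr openU metric_g a j k Wz.

Let chr_rl a j k z (Wz : W z) :
  christoffel G (rgt a) (rgt j) (lft k) z = - christoffel g j k a (lsubmx z) :=
  christoffel_fibre_rl openU metric_g a j k Wz.

Let chr_ll a j k z (Wz : W z) :
  christoffel G (rgt a) (lft j) (lft k) z = fibre_linear (fun r => fchr r a j k) z :=
  christoffel_fibre_ll openU metric_g a j k Wz.

Let dchr_base_l m a j k z : W z ->
  partial (lft m) (christoffel G (lft a) (lft j) (lft k)) z =
  partial m (christoffel g a j k) (lsubmx z).
Proof.
move=> Wz; rewrite (partial_ext_on openW _ Wz (chr_base a j k)).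
by rewrite partial_lsubmx_l.
Qed.

Let dchr_base_r m a j k z : W z ->
  partial (rgt m) (christoffel G (lft a) (lft j) (lft k)) z = 0.
Proof.
move=> Wz; rewrite (partial_ext_on openW _ Wz (chr_base a j k)).
by rewrite partial_lsubmx_r.
Qed.

Let dchr_base_mixed M a j K z :
  partial M (christoffel G (lft a) (rgt j) K) z = 0.
Proof.
rewrite (_ : christoffel G _ _ _ = fun=> 0); first exact: partial_cst.
by apply/funext => y; exact: christoffel_base_mixed.
Qed.

Let dchr_base_mixed' M a J k z :
  partial M (christoffel G (lft a) J (rgt k)) z = 0.
Proof.
rewrite (_ : christoffel G _ _ _ = fun=> 0); first exact: partial_cst.
by apply/funext => y; exact: christoffel_base_mixed'.
Qed.

Let dchr_rr M a j k z : partial M (christoffel G (rgt a) (rgt j) (rgt k)) z = 0.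
Proof.
rewrite (_ : christoffel G _ _ _ = fun=> 0); first exact: partial_cst.
by apply/funext => y; exact: chr_rr.
Qed.

Let smooth_lift M i j k z : W z ->
  derivable (fun y => christoffel g i j k (lsubmx y)) z (delta_mx 0 M).
Proof. exact: (smooth_derivable (smooth_lsubmx (smooth_chr i j k))). Qed.

Let dchr_lr_l m a j k z : W z ->
  partial (lft m) (christoffel G (rgt a) (lft j) (rgt k)) z =
  - partial m (christoffel g k j a) (lsubmx z).
Proof.
move=> Wz; rewrite (partial_ext_on openW _ Wz (chr_lr a j k)).
by rewrite (partialN (smooth_lift Wz)) partial_lsubmx_l.
Qed.

Let dchr_lr_r m a j k z : W z ->
  partial (rgt m) (christoffel G (rgt a) (lft j) (rgt k)) z = 0.
Proof.
move=> Wz; rewrite (partial_ext_on openW _ Wz (chr_lr a j k)).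
by rewrite (partialN (smooth_lift Wz)) partial_lsubmx_r oppr0.
Qed.

Let dchr_rl_l m a j k z : W z ->
  partial (lft m) (christoffel G (rgt a) (rgt j) (lft k)) z =
  - partial m (christoffel g j k a) (lsubmx z).
Proof.
move=> Wz; rewrite (partial_ext_on openW _ Wz (chr_rl a j k)).
by rewrite (partialN (smooth_lift Wz)) partial_lsubmx_l.
Qed.

Let dchr_rl_r m a j k z : W z ->
  partial (rgt m) (christoffel G (rgt a) (rgt j) (lft k)) z = 0.
Proof.
move=> Wz; rewrite (partial_ext_on openW _ Wz (chr_rl a j k)).
by rewrite (partialN (smooth_lift Wz)) partial_lsubmx_r oppr0.
Qed.

Let dchr_ll_l m a j k z : W z ->
  partial (lft m) (christoffel G (rgt a) (lft j) (lft k)) z =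
  fibre_linear (fun r => partial m (fchr r a j k)) z.
Proof.
move=> Wz; rewrite (partial_ext_on openW _ Wz (chr_ll a j k)).
exact: (partial_fibre_linear_l openU (fun r => smooth_fchr r a j k)).
Qed.

Let dchr_ll_r m a j k z : W z ->
  partial (rgt m) (christoffel G (rgt a) (lft j) (lft k)) z = fchr m a j k (lsubmx z).
Proof.
move=> Wz; rewrite (partial_ext_on openW _ Wz (chr_ll a j k)).
exact: (partial_fibre_linear_r openU (fun r => smooth_fchr r a j k)).
Qed.

Let curvature_up_base a j k l z : W z ->
  curvature_up G (lft a) (lft j) (lft k) (lft l) z =
  lambda * ((a == k)%:R * g (lsubmx z) j l - (a == l)%:R * g (lsubmx z) j k).
Proof.
move=> Wz; rewrite -(curvature_up_constant metric_g _ _ _ _ curvature_g Wz).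
rewrite /curvature_up !dchr_base_l// big_split_ord/=; congr (_ + _).
rewrite [X in _ + X]big1 => [|m _]; last first.
  by rewrite !christoffel_base_mixed' !mul0r subrr.
by rewrite addr0; apply: eq_bigr => m _; rewrite !chr_base.
Qed.

Let curvature_up_base_J a j K L z : curvature_up G (lft a) (rgt j) K L z = 0.
Proof.
rewrite /curvature_up !dchr_base_mixed' subrr add0r big1// => M _.
have [m ->|m ->] := split_ordP M.
  by rewrite !christoffel_base_mixed' !mulr0 subrr.
by rewrite !christoffel_base_mixed' !mul0r subrr.
Qed.

Let curvature_up_base_K a J k L z : W z -> curvature_up G (lft a) J (rgt k) L z = 0.
Proof.
move=> Wz; rewrite /curvature_up dchr_base_mixed subr0 big1 => [|M _].
  rewrite addr0; have [l ->|l ->] := split_ordP L; last exact: dchr_base_mixed.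
  have [j ->|j ->] := split_ordP J; last exact: dchr_base_mixed'.
  exact: dchr_base_r.
rewrite christoffel_base_mixed mul0r sub0r.
have [m ->|m ->] := split_ordP M.
  by rewrite christoffel_base_mixed mulr0 oppr0.
by rewrite christoffel_base_mixed' mul0r oppr0.
Qed.

(** The dual connection acts here, and its curvature is minus the transpose of that of g. *)
Let curvature_up_fibre_rll a j k l z : W z ->
  curvature_up G (rgt a) (rgt j) (lft k) (lft l) z =
  lambda * (g (lsubmx z) a k * (j == l)%:R - g (lsubmx z) a l * (j == k)%:R).
Proof.
move=> Wz; transitivity (- curvature_up g j a k l (lsubmx z)); last first.
  by rewrite (curvature_up_constant metric_g _ _ _ _ curvature_g Wz); ring.
rewrite /curvature_up !dchr_lr_l// big_split_ord/=.
rewrite [X in _ + (X + _) = _]big1 => [|m _]; last first.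
  by rewrite !christoffel_base_mixed' !mulr0 subrr.
rewrite add0r opprD -sumrN; congr (_ + _); first by rewrite opprB opprK addrC.
apply: eq_bigr => m _; rewrite !(fun a j k => chr_lr a j k Wz) !mulrNN opprB.
rewrite [christoffel g m l a _ * _]mulrC.
by rewrite [christoffel g m k a _ * _]mulrC.
Qed.

Let curvature_up_fibre_lrl a j k l z : W z ->
  curvature_up G (rgt a) (lft j) (rgt k) (lft l) z =
  lambda * ((a == k)%:R * g (lsubmx z) j l - g (lsubmx z) a l * (j == k)%:R).
Proof.
move=> Wz; transitivity (curvature_up g k l a j (lsubmx z)); last first.
  rewrite (curvature_up_constant metric_g _ _ _ _ curvature_g Wz).
  rewrite (metric_sym metric_g j l Wz) (metric_sym metric_g a l Wz).
  by rewrite (eq_sym k a) (eq_sym k j); ring.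
rewrite /curvature_up dchr_ll_r// dchr_rl_l// big_split_ord/=.
set x := lsubmx z.
pose S := \sum_m christoffel g k a m x * christoffel g m l j x.
pose T := \sum_m christoffel g k j m x * christoffel g m l a x.
have -> : \sum_m (christoffel G (rgt a) (rgt k) (lft m) z *
      christoffel G (lft m) (lft l) (lft j) z
    - christoffel G (rgt a) (lft l) (lft m) z *
      christoffel G (lft m) (rgt k) (lft j) z) = - S.
  rewrite -sumrN; apply: eq_bigr => m _.
  rewrite christoffel_base_mixed mulr0 subr0 (chr_rl _ _ _ Wz) (chr_base _ _ _ Wz).
  by rewrite (christoffel_sym openU metric_g k m a Wz) mulNr.
have -> : \sum_m (christoffel G (rgt a) (rgt k) (rgt m) z *
      christoffel G (rgt m) (lft l) (lft j) z
    - christoffel G (rgt a) (lft l) (rgt m) z *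
      christoffel G (rgt m) (rgt k) (lft j) z) = - T.
  rewrite -sumrN; apply: eq_bigr => m _.
  rewrite chr_rr mul0r sub0r (chr_lr _ _ _ Wz) (chr_rl _ _ _ Wz) mulrNN.
  by congr (- _); exact: mulrC.
have -> : \sum_m (christoffel g k a m x * christoffel g m j l x
    - christoffel g k j m x * christoffel g m a l x) = S - T.
  rewrite -sumrB; apply: eq_bigr => m _.
  by rewrite (christoffel_sym openU metric_g m j l Wz)
    (christoffel_sym openU metric_g m a l Wz).
(* The derivative of the fibre symbol along psi_k is its coefficient [fchr k a l j]. Its term along
   x^l cancels against the mixed symbol, and 2S - S - T = S - T completes R^k_(laj). *)
have simp (u v w s t : R) : u - v - w + 2 * s - - v + (- s + - t) = u - w + (s - t).
  by ring.
have -> : partial a (christoffel g k j l) x = partial a (christoffel g k l j) x :=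
  dchr_sym Wz a k j l.
have -> : partial j (christoffel g k a l) x = partial j (christoffel g k l a) x :=
  dchr_sym Wz j k a l.
exact: simp.
Qed.

Let curvature_up_fibre_rrK a j k L z : W z ->
  curvature_up G (rgt a) (rgt j) (rgt k) L z = 0.
Proof.
move=> Wz; rewrite /curvature_up dchr_rr subr0.
have -> : partial (rgt k) (christoffel G (rgt a) L (rgt j)) z = 0.
  by have [l ->|l ->] := split_ordP L; [exact: dchr_lr_r | exact: dchr_rr].
rewrite add0r big1// => M _; have [m ->|m ->] := split_ordP M.
  by rewrite !christoffel_base_mixed' !mulr0 subrr.
by rewrite !chr_rr mul0r mulr0 subrr.
Qed.

Let curvature_up_fibre_lrr a j k l z : W z ->
  curvature_up G (rgt a) (lft j) (rgt k) (rgt l) z = 0.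
Proof.
move=> Wz; rewrite /curvature_up !dchr_rl_r// subrr add0r big1// => M _.
have [m ->|m ->] := split_ordP M.
  by rewrite !christoffel_base_mixed !mulr0 subrr.
by rewrite !chr_rr !mul0r subrr.
Qed.

(** Both sides are linear in psi, the right one through [G] alone; the coefficients of psi_r are
    compared by [fibre_curvature_alg]. *)
Let curvature_up_fibre_lll a j k l z : W z ->
  curvature_up G (rgt a) (lft j) (lft k) (lft l) z =
  lambda * (g (lsubmx z) a k * G z (lft j) (lft l)
            - g (lsubmx z) a l * G z (lft j) (lft k)).
Proof.
move=> Wz; set x := lsubmx z.
pose psi r := rsubmx z 0 r; pose c := christoffel g.
rewrite /curvature_up !dchr_ll_l// big_split_ord/=.
have -> : \sum_m (christoffel G (rgt a) (lft k) (lft m) z *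
      christoffel G (lft m) (lft l) (lft j) z
    - christoffel G (rgt a) (lft l) (lft m) z *
      christoffel G (lft m) (lft k) (lft j) z) =
  \sum_r (\sum_m (fchr r a k m x * c m l j x - fchr r a l m x * c m k j x)) * psi r.
  under [RHS]eq_bigr do rewrite mulr_suml.
  rewrite exchange_big/=; apply: eq_bigr => m _.
  rewrite !(fun a j k => chr_ll a j k Wz) !(fun a j k => chr_base a j k Wz).
  rewrite /fibre_linear !mulr_suml -sumrB; apply: eq_bigr => r _.
  by rewrite mulrBl mulrAC; congr (_ - _); exact: mulrAC.
have -> : \sum_m (christoffel G (rgt a) (lft k) (rgt m) z *
      christoffel G (rgt m) (lft l) (lft j) z
    - christoffel G (rgt a) (lft l) (rgt m) z *
      christoffel G (rgt m) (lft k) (lft j) z) =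
  \sum_r (\sum_m (c m l a x * fchr r m k j x - c m k a x * fchr r m l j x)) * psi r.
  under [RHS]eq_bigr do rewrite mulr_suml.
  rewrite exchange_big/=; apply: eq_bigr => m _.
  rewrite !(fun a j k => chr_ll a j k Wz) !(fun a j k => chr_lr a j k Wz).
  rewrite !mulNr opprK addrC /fibre_linear !mulr_sumr -sumrB.
  by apply: eq_bigr => r _; rewrite mulrBl !mulrA.
rewrite !riemann_extension_ll /fibre_linear -!/x.
have -> : lambda * (g x a k * (-2 * \sum_r c r j l x * psi r)
    - g x a l * (-2 * \sum_r c r j k x * psi r)) =
  \sum_r (-2 * lambda * (g x a k * c r j l x - g x a l * c r j k x)) * psi r.
  rewrite !mulr_sumr -sumrB mulr_sumr; apply: eq_bigr => r _.
  by move: (c r j l x) (c r j k x) (psi r) => u v w; ring.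
rewrite -sumrB -!big_split/=; apply: eq_bigr => r _.
rewrite -mulrBl -!mulrDl; congr (_ * _).
rewrite !partial_fibre_christoffel//.
rewrite (partial_comm openU k l (smooth_chr r j a) Wz).
have dqE m i' k' : dmetric_at x m i' k' = \sum_p
    (chr_at x p i' m * g x p k' + chr_at x p k' m * g x i' p).
  exact: (partial_metric openU metric_g).
rewrite -(fibre_curvature_alg (chr_sym Wz) (dchr_sym Wz)
  (fun i j => metric_sym metric_g i j Wz) dqE (base_curvature Wz)).
(* [w] is the second derivative, common to both terms once the order of differentiation has been
   exchanged. *)
have cancel (u v w s t : R) : u - w - (v - w) + (s + t) = u - v + s + t by ring.
exact: cancel.
Qed.

Definition pullback_metric z : 'M[R]_(n + n) := block_mx (g (lsubmx z)) 0 0 0.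

Local Notation q := pullback_metric.

(** The pullback of g with its first index raised by the inverse of [G]; it sends base directions to
    fibre directions. *)
Let raised z : 'M[R]_(n + n) := block_mx 0 0 (g (lsubmx z)) 0.

Lemma curvature_up_riemann_extension I J K L z : W z ->
  curvature_up G I J K L z =
  lambda * ((I == K)%:R * q z J L - (I == L)%:R * q z J K
            + (raised z I K * G z J L - raised z I L * G z J K)).
Proof.
(* Antisymmetry in the last two indices brings a base-fibre pair to the fibre-base order of the
   component formulas. *)
move=> Wz; have wlogKL k l : curvature_up G I J (lft k) (rgt l) z =
    - curvature_up G I J (rgt l) (lft k) z by exact: curvature_up_antisym.
have [i Ei|i Ei] := split_ordP I; have [j Ej|j Ej] := split_ordP J;
  have [k Ek|k Ek] := split_ordP K; have [l El|l El] := split_ordP L;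
  rewrite {}Ei {}Ej in wlogKL *; rewrite {}Ek {}El ?wlogKL {wlogKL} /raised /q
  ?riemann_extension_ll ?riemann_extension_lr ?riemann_extension_rl
  ?riemann_extension_rr ?block_mxEul ?block_mxEur ?block_mxEdl ?block_mxEdr ?mxE
  ?eq_lrshift ?eq_rlshift ?eq_lshift ?eq_rshift
  ?curvature_up_base_J ?(curvature_up_base_K _ _ _ _ Wz)
  ?(curvature_up_fibre_rrK _ _ _ _ Wz) ?(curvature_up_fibre_lrr _ _ _ _ Wz)
  ?(curvature_up_base _ _ _ _ Wz) ?(curvature_up_fibre_rll _ _ _ _ Wz)
  ?(curvature_up_fibre_lrl _ _ _ _ Wz) ?(curvature_up_fibre_lll _ _ _ _ Wz)
  ?riemann_extension_ll;
  rewrite /= ?mulr0n; ring.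
Qed.

(** Lowering the first index by [G] turns the Kronecker deltas into [G] and [raised] into [q]. *)
Lemma curvature_riemann_extension I J K L z : W z ->
  curvature G I J K L z = lambda * kulkarni_nomizu G q I J K L z.
Proof.
move=> Wz; rewrite /curvature /kulkarni_nomizu.
have raisedE A B : \sum_M G z A M * raised z M B = q z A B.
  transitivity ((G z *m raised z) A B); first by rewrite [RHS]mxE.
  by rewrite /riemann_extension mulmx_block !mulmx0 !mul0mx !mul1mx !addr0 !add0r.
have deltaE A B : \sum_M G z A M * (M == B)%:R = G z A B.
  rewrite (bigD1 B)//= eqxx mulr1 big1 ?addr0// => M MB.
  by rewrite (negbTE MB) mulr0.
rewrite -(deltaE I K) -(deltaE I L) -(raisedE I K) -(raisedE I L).
rewrite !mulr_suml -!sumrB -big_split/= mulr_sumr.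
apply: eq_bigr => M _; rewrite curvature_up_riemann_extension//.
move: (G z) (q z) (raised z) => u v w; ring.
Qed.

Lemma parallel_pullback_metric z : W z -> parallel G q z.
Proof.
move=> Wz I K M.
have smq : smooth_on W (fun y => q y I K).
  have [i ->|i ->] := split_ordP I; have [k ->|k ->] := split_ordP K.
  - rewrite (_ : (fun y => _) = fun y => g (lsubmx y) i k).
      exact: (smooth_lsubmx (smooth_metric metric_g i k)).
    by apply/funext => y; rewrite /q block_mxEul.
  - rewrite (_ : (fun y => _) = fun=> 0); first exact: smooth_cst.
    by apply/funext => y; rewrite /q block_mxEur mxE.
  - rewrite (_ : (fun y => _) = fun=> 0); first exact: smooth_cst.
    by apply/funext => y; rewrite /q block_mxEdl mxE.
  - rewrite (_ : (fun y => _) = fun=> 0); first exact: smooth_cst.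
    by apply/funext => y; rewrite /q block_mxEdr mxE.
split; first exact: smooth_derivable smq Wz.
rewrite big_split_ord/=.
(* [q] vanishes as soon as one index is a fibre index, so only base indices contribute to the
   contraction. *)
rewrite [X in _ = _ + X]big1 ?addr0 => [|p _]; last first.
  rewrite (_ : q z (rgt p) K = 0); last first.
    have [k ->|k ->] := split_ordP K; first by rewrite /q block_mxEdl mxE.
    by rewrite /q block_mxEdr mxE.
  rewrite (_ : q z I (rgt p) = 0) ?mulr0 ?addr0//.
  have [i ->|i ->] := split_ordP I; first by rewrite /q block_mxEur mxE.
  by rewrite /q block_mxEdr mxE.
have [i Ei|i Ei] := split_ordP I; last first.
  rewrite (_ : (fun y => q y I K) = fun=> 0); last first.
    apply/funext => y; rewrite Ei /q.
    by have [k ->|k ->] := split_ordP K; rewrite ?block_mxEdl ?block_mxEdr mxE.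
  rewrite partial_cst big1// => p _.
  by rewrite Ei christoffel_base_mixed mul0r add0r /q block_mxEdl mxE mulr0.
have [k Ek|k Ek] := split_ordP K; last first.
  rewrite (_ : (fun y => q y I K) = fun=> 0); last first.
    by apply/funext => y; rewrite Ei Ek /q block_mxEur mxE.
  rewrite partial_cst big1// => p _.
  by rewrite Ek christoffel_base_mixed mul0r addr0 /q block_mxEur mxE mulr0.
rewrite Ei Ek (_ : (fun y => _) = fun y => g (lsubmx y) i k); last first.
  by apply/funext => y; rewrite /q block_mxEul.
have [m ->|m ->] := split_ordP M.
  rewrite (partial_lsubmx_l (fun x => g x i k)) (partial_metric openU metric_g i k m Wz).
  apply: eq_bigr => p _; rewrite !(fun a j k => chr_base a j k Wz).
  by rewrite /q !block_mxEul.
rewrite (partial_lsubmx_r (fun x => g x i k)) big1// => p _.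
by rewrite !christoffel_base_mixed' !mul0r addr0.
Qed.

Lemma riemann_extension_symmetric z : W z -> forall I J K L M,
  covariant_derivative G (curvature G) I J K L M z = 0.
Proof.
move=> Wz I J K L M.
rewrite -(covariant_derivative_parallel (g := G) lambda
  (parallel_metric openW (metric_riemann_extension openU metric_g) Wz)
  (parallel_pullback_metric Wz) I J K L M).
rewrite /covariant_derivative.
(* The closed form of the curvature holds on all of the open set [W], so it may also be substituted
   under the derivative. *)
rewrite (partial_ext_on openW _ Wz (curvature_riemann_extension I J K L)).
by congr (_ - _); apply: eq_bigr => P _; rewrite !curvature_riemann_extension.
Qed.

End RiemannExtensionCurvature.

Theorem theorem2 (R : realType) (U : set 'rV[R]_3) (g : 'rV[R]_3 -> 'M[R]_3)
    (lambda : R) (openU : open U) (metric_g : metric_on U g)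
    (curvature_g : constant_curvature U g lambda) :
  forall z : 'rV[R]_(3 + 3), U (lsubmx z) ->
  forall i j k l m : 'I_(3 + 3),
    covariant_derivative (riemann_extension g)
      (curvature (riemann_extension g)) i j k l m z = 0.
Proof. exact: (riemann_extension_symmetric openU metric_g curvature_g). Qed.
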